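(* Let $F_1,\dots,F_8\in\mathbb{C}[x,y,z]$ be linear forms such that the eight planes in $\mathbb{P}^3$ (coordinates $(x:y:z:t)$) given by $F_1=0,\dots,F_4=0$, $F_5+t=0$, $F_6+t=0$, $F_7+t=0$, $F_8+t=0$ form an octic arrangement; thus $A=(0:0:0:1)$ is a fourfold point of the arrangement (exactly four of the planes contain it). Then the double octic Calabi–Yau threefold defined by $$u^{2}=F_{1}F_{2}F_{3}F_{4}(F_{5}+t)(F_{6}+t)(F_{7}+t)(F_{8}+t)$$ is birational to the elliptic fibration (over $\mathbb{P}^2$ with coordinates $(x:y:z)$, with fibre coordinates $(t,u)$) $$u^{2}=\bigl(F_{1}F_{2}F_{3}F_{4} (F_{5} - F_{7}) (F_{5} - F_{6}) + t\bigr)\bigl(F_{1}F_{2}F_{3}F_{4} (F_{5} - F_{8}) (F_{5} - F_{6}) + t\bigr)\bigl(F_{1}F_{2}F_{3}F_{4} (F_{5} - F_{8}) (F_{5} - F_{7}) + t\bigr),$$ whose discriminant is $$\Delta = 16 (F_{1}F_{2}F_{3}F_{4})^{6}\prod_{5\le i<j\le 8}(F_{i}-F_{j})^{2}$$ and whose $J$-invariant is $$J = \frac{4\left(6F_{5}F_{6}F_{7}F_{8}-\sum\limits_{5\le i<j<k\le 8}F_{i}F_{j}F_{k}(F_{i}+F_{j}+F_{k}) + \sum\limits_{5\le i<j\le 8}F_{i}^{2}F_{j}^{2}\right)^{3}}{27\prod\limits_{5\le i<j\le 8}(F_{i}-F_{j})^{2}}.$$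
   Context: An octic arrangement is a union $D=P_1\cup\dots\cup P_8$ of eight distinct planes in $\mathbb{P}^3=\mathbb{P}^3_{\mathbb{C}}$ such that no six of the planes meet in a point and no four contain a common line. If $P_i$ has equation $\ell_i(x,y,z,t)=0$, the double octic defined by $D$ is a Calabi–Yau threefold obtained as a crepant resolution of the double cover of $\mathbb{P}^3$ branched along $D$, i.e. of the hypersurface $u^2=\ell_1\cdots \ell_8$ in the weighted projective space $\mathbb{P}(1,1,1,1,4)$; for birational questions it can be replaced by this hypersurface. The right-hand side of the elliptic fibration is homogeneous when $x,y,z$ have weight $1$, $t$ has weight $6$ and $u$ has weight $9$; equivalently, dehomogenizing (e.g. $z=1$), it is an elliptic curve over the function field of $\mathbb{P}^2$. For $u^2=(t-e_1)(t-e_2)(t-e_3)$ the discriminant is $\Delta=16\prod_{i<j}(e_i-e_j)^2$ and the $J$-invariant is normalized as $J=j/1728$, where $j$ is the usual $j$-invariant (so $J=1$ for $u^2=t^3-t$). *)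

(* Defs.v *)
From HB Require Import structures.
From mathcomp Require Import all_boot all_order all_algebra.
From mathcomp Require Import classical_sets reals.
From mathcomp Require Import complex.
From mathcomp Require Import mpoly.
From mathcomp Require Import ring.

Set Implicit Arguments.
Unset Strict Implicit.
Unset Printing Implicit Defensive.

Import GRing.Theory.

Local Open Scope classical_set_scope.
Local Open Scope ring_scope.

(* Quasi-projective varieties in weighted projective spaces, in the language of
   closed points: a point of P(w_0, ..., w_{n-1}) is represented by a nonzero
   row vector, two vectors representing the same point when they are [wsame].
   Subsets are given by sets of representatives.  The definitions follow
   Hartshorne I.1-I.4 and are meant over an algebraically closed field. *)
Section WeightedProjective.
Variable K : closedFieldType.

Definition whomogeneous n (w : 'I_n -> nat) (d : nat) (g : {mpoly K[n]}) :=
  forall m, m \in msupp g -> (\sum_(i < n) w i * m i)%N = d.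

Definition wsame n (w : 'I_n -> nat) (p q : 'rV[K]_n) :=
  exists2 c : K, c != 0 & forall i, q 0 i = c ^+ w i * p 0 i.

(* U is relatively Zariski-open in X: it is the complement in X of the common
   zero locus of a family T of weighted homogeneous polynomials. *)
Definition wopen_in n (w : 'I_n -> nat) (X U : set 'rV[K]_n) :=
  exists2 T : set {mpoly K[n]},
    forall g, T g -> exists d, whomogeneous w d g
  & forall p, U p <-> X p /\ exists2 g, T g & g.@[p 0] != 0.

Definition wdense_in n (w : 'I_n -> nat) (X U : set 'rV[K]_n) :=
  forall V, wopen_in w X V -> V !=set0 -> (V `&` U) !=set0.

(* Regular functions: locally quotients of weighted homogeneous polynomials of
   the same degree. *)
Definition wregular n (w : 'I_n -> nat) (U : set 'rV[K]_n) (f : 'rV[K]_n -> K) :=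
  forall p, U p -> exists V, [/\ wopen_in w U V, V p &
    exists d (g h : {mpoly K[n]}),
      [/\ whomogeneous w d g, whomogeneous w d h &
          forall q, V q -> h.@[q 0] != 0 /\ f q = g.@[q 0] / h.@[q 0]]].

(* Morphisms: continuous maps pulling back regular functions to regular
   functions. *)
Definition wmorphism n (w : 'I_n -> nat) m (w' : 'I_m -> nat)
    (U : set 'rV[K]_n) (V : set 'rV[K]_m) (phi : 'rV[K]_n -> 'rV[K]_m) :=
  [/\ forall p, U p -> V (phi p),
      forall p q, U p -> U q -> wsame w p q -> wsame w' (phi p) (phi q),
      forall W, wopen_in w' V W -> wopen_in w U (U `&` phi @^-1` W)
    & forall W f, wopen_in w' V W -> wregular w' W f ->
        wregular w (U `&` phi @^-1` W) (f \o phi)].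

Definition wisomorphic n (w : 'I_n -> nat) m (w' : 'I_m -> nat)
    (U : set 'rV[K]_n) (V : set 'rV[K]_m) :=
  exists phi psi,
    [/\ wmorphism w w' U V phi, wmorphism w' w V U psi,
        forall p, U p -> wsame w (psi (phi p)) p
      & forall q, V q -> wsame w' (phi (psi q)) q].

Definition birational n (w : 'I_n -> nat) m (w' : 'I_m -> nat)
    (X : set 'rV[K]_n) (Y : set 'rV[K]_m) :=
  exists U V,
    [/\ wopen_in w X U /\ wdense_in w X U,
        wopen_in w' Y V /\ wdense_in w' Y V
      & wisomorphic w w' U V].

(* The hypersurface u ^ 2 = G(x, y, z, t); the coordinates are ordered
   x, y, z, t, u. *)
Definition double_cover (G : {mpoly K[4]}) : set 'rV[K]_5 :=
  [set p : 'rV[K]_5 | p != 0 /\ ('X_ord_max ^+ 2 - mwiden G).@[p 0] = 0].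

Definition double_octic_weights : 'I_5 -> nat := tnth [tuple 1; 1; 1; 1; 4]%N.

Definition fibration_weights : 'I_5 -> nat := tnth [tuple 1; 1; 1; 6; 9]%N.

(* The part of [double_cover G] on which the projection (x : y : z) to P^2 is
   defined: the total space, over P^2, of the family of affine plane curves
   u ^ 2 = G(x, y, z, t) in the coordinates (t, u). *)
Definition fibration_over_P2 (G : {mpoly K[4]}) : set 'rV[K]_5 :=
  [set p : 'rV[K]_5 |
     double_cover G p /\ exists i : 'I_5, (i < 3)%N /\ p 0 i != 0].

End WeightedProjective.

Section Arrangement.
Variable K : closedFieldType.

Definition plane (l : {mpoly K[4]}) : set 'rV[K]_4 :=
  [set p : 'rV[K]_4 | p != 0 /\ l.@[p 0] = 0].

(* Lines of P^3 are the row spaces of the 2 x 4 matrices of rank 2. *)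
Definition octic_arrangement (l : 'I_8 -> {mpoly K[4]}) :=
  [/\ forall i, l i \is 1.-homog /\ l i != 0,
      injective (fun i => plane (l i)),
      forall S : {set 'I_8}, #|S| = 6%N ->
        ~ exists p, forall i, i \in S -> plane (l i) p
    & forall S : {set 'I_8}, #|S| = 4%N ->
        ~ exists2 L : 'M[K]_(2, 4), row_free L &
            forall i, i \in S ->
            forall p : 'rV[K]_4, p != 0 -> (p <= L)%MS -> plane (l i) p].

(* F_1, ..., F_4, F_5 + t, ..., F_8 + t *)
Definition fourfold_planes (F : nat -> {mpoly K[3]}) (i : 'I_8) : {mpoly K[4]} :=
  if (i < 4)%N then mwiden (F i.+1) else mwiden (F i.+1) + 'X_ord_max.

End Arrangement.

(* The curve u ^ 2 = p(t), for p a monic cubic polynomial over L, as a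
   Weierstrass curve with a_1 = a_3 = 0, and its standard invariants. *)
Section Weierstrass.
Variables (L : fieldType) (p : {poly L}).

Definition wc_b2 := 4 * p`_2.
Definition wc_b4 := 2 * p`_1.
Definition wc_b6 := 4 * p`_0.
Definition wc_b8 := 4 * p`_2 * p`_0 - p`_1 ^+ 2.
Definition wc_c4 := wc_b2 ^+ 2 - 24 * wc_b4.
Definition wc_disc :=
  - wc_b2 ^+ 2 * wc_b8 - 8 * wc_b4 ^+ 3 - 27 * wc_b6 ^+ 2
  + 9 * wc_b2 * wc_b4 * wc_b6.
Definition wc_j := wc_c4 ^+ 3 / wc_disc.
Definition wc_J := wc_j / 1728.

Definition elliptic_cubic := [/\ p \is monic, size p = 4%N & wc_disc != 0].

End Weierstrass.

Lemma wc_disc_split (L : fieldType) (e1 e2 e3 : L) :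
  wc_disc (('X - e1%:P) * ('X - e2%:P) * ('X - e3%:P)) =
  16 * ((e1 - e2) ^+ 2 * (e1 - e3) ^+ 2 * (e2 - e3) ^+ 2).
Proof.
have -> : ('X - e1%:P) * ('X - e2%:P) * ('X - e3%:P) =
    'X^3 - (e1 + e2 + e3)%:P * 'X^2 + (e1 * e2 + e1 * e3 + e2 * e3)%:P * 'X
    - (e1 * e2 * e3)%:P by rewrite !polyCD !polyCM; ring.
rewrite /wc_disc /wc_b2 /wc_b4 /wc_b6 /wc_b8.
rewrite !(coefB, coefD, coefCM, coefXn, coefX, coefC) /=; ring.
Qed.

Lemma wc_J_lemniscatic (L : fieldType) :
  (2 : L) != 0 -> (3 : L) != 0 -> wc_J ('X^3 - 'X : {poly L}) = 1.
Proof.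
move=> h2 h3; rewrite /wc_J /wc_j /wc_c4 /wc_disc /wc_b2 /wc_b4 /wc_b6 /wc_b8.
rewrite !(coefB, coefXn, coefX) /=.
have e1728 : (1728 : L) != 0.
  by have -> : (1728 : L) = 2 ^+ 6 * 3 ^+ 3; [ring | rewrite mulf_neq0 ?expf_neq0].
have e64 : (64 : L) != 0.
  by have -> : (64 : L) = 2 ^+ 6; [ring | rewrite expf_neq0].
set d := (X in _ / X / _).
have -> : d = 64 by rewrite /d; ring.
by field; rewrite e1728.
Qed.

(* For G in C[x, y, z, t], the right-hand side of u ^ 2 = G as a polynomial in t
   over the field C(x, y, z). *)
Definition generic_fibre (K : closedFieldType) (G : {mpoly K[4]}) :
    {poly {fraction {mpoly K[3]}}} :=
  map_poly (@FracField.tofrac {mpoly K[3]}) (muni G).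

(* Main.v *)
(* Put s = F_5 + t and Q = F_1 F_2 F_3 F_4 (F_5 - F_6) (F_5 - F_7) (F_5 - F_8).
   Dividing the equation of the double octic by s ^ 4 turns its right-hand side
   into a cubic in 1 / s, which rescaling by Q makes monic: over each point of
   P^2 the birational map is (t, u) |-> (- Q / s, Q u / s ^ 2), with inverse
   (t, u) |-> (- Q / t - F_5, Q u / t ^ 2).  Both maps are given by weighted
   homogeneous numerators over a common denominator, and this makes them
   morphisms between the loci Q s <> 0 and Q t <> 0. *)
Require Import Defs.
From HB Require Import structures.
From mathcomp Require Import all_boot all_order all_algebra.
From mathcomp Require Import classical_sets reals.
From mathcomp Require Import complex.
From mathcomp Require Import mpoly.
From mathcomp Require Import ring.

Set Implicit Arguments.
Unset Strict Implicit.
Unset Printing Implicit Defensive.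

Import GRing.Theory.

Local Open Scope ring_scope.

Local Notation widen := (widen_ord (leqnSn _)).

(** * Polynomials in n + 1 variables as univariate polynomials in the last one *)

Lemma meval_mwiden (R : comNzRingType) n (v : 'I_n.+1 -> R) (p : {mpoly R[n]}) :
  (mwiden p).@[v] = p.@[v \o widen].
Proof.
rewrite [RHS]mevalE [in LHS](mpolyE p) (raddf_sum (@mwiden n R)) (raddf_sum (meval v)).
apply: eq_bigr => m _.
rewrite /= mwidenZ mwidenX mevalZ mevalX big_ord_recr /= mnmwiden_ordmax expr0 mulr1.
by congr (_ * _); apply: eq_bigr => i _; rewrite mnmwiden_widen.
Qed.

Lemma horner_muni (R : comNzRingType) n (p : {mpoly R[n.+1]}) :
  (map_poly (@mwiden n R) (muni p)).['X_ord_max] = p.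
Proof.
rewrite muniE [in RHS](mpolyE p) rmorph_sum horner_sum.
apply: eq_bigr => m _; rewrite -mul_polyC rmorphM /= map_polyC map_polyXn /=.
rewrite hornerCM hornerXn -mul_mpolyC mwidenM mwidenC mwidenX -mulrA mul_mpolyC.
congr (_ *: _); rewrite mpolyXE_id [RHS]mpolyXE_id !big_ord_recr /= mnmwiden_ordmax.
rewrite expr0 mulr1; congr (_ * _).
by apply: eq_bigr => i _; rewrite mnmwiden_widen mnmE.
Qed.

Lemma muni_mwiden (R : comNzRingType) n (p : {mpoly R[n]}) :
  muni (mwiden p) = p%:P.
Proof.
rewrite [in LHS](mpolyE p) [in RHS](mpolyE p) (raddf_sum (@mwiden n R)).
rewrite (raddf_sum (@muni n R)) (raddf_sum polyC).
apply: eq_bigr => m _; rewrite /= mwidenZ mwidenX muniZ muniE msuppX big_seq1.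
rewrite mcoeffX eqxx scale1r mnmwiden_ordmax expr0 alg_polyC -mul_mpolyC polyCM mul_polyC.
by congr (_ *: ('X_[_])%:P); apply/mnmP => i; rewrite mnmE mnmwiden_widen.
Qed.

Lemma muni_Xmax (R : comNzRingType) n : muni 'X_ord_max = 'X :> {poly {mpoly R[n]}}.
Proof.
rewrite muniE msuppX big_seq1 mcoeffX eqxx scale1r mnm1E eqxx expr1.
rewrite (_ : [multinom _ | i < n] = 0%MM) ?mpolyX0 ?scale1r //.
by apply/mnmP => i; rewrite mnmE mnm1E mnm0E -val_eqE /= eqn_leq leqNgt ltn_ord.
Qed.

Lemma meval_muni (R : comNzRingType) n (v : 'I_n.+1 -> R) (p : {mpoly R[n.+1]}) :
  p.@[v] = (map_poly (meval (v \o widen)) (muni p)).[v ord_max].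
Proof.
rewrite -[in LHS](horner_muni p) -horner_map /= mevalXU -map_poly_comp; congr _.[_].
by apply: eq_map_poly => q /=; rewrite meval_mwiden.
Qed.

Definition extend (R : Type) n (v : 'I_n -> R) (x : R) (i : 'I_n.+1) : R :=
  oapp v x (unlift ord_max i).

Lemma extend_max (R : Type) n (v : 'I_n -> R) x : extend v x ord_max = x.
Proof. by rewrite /extend unlift_none. Qed.

Lemma extend_widen (R : Type) n (v : 'I_n -> R) x i : extend v x (widen i) = v i.
Proof.
have -> : widen i = lift ord_max i by apply: val_inj; rewrite /= /bump leqNgt ltn_ord.
by rewrite /extend liftK.
Qed.

(** Induction on the number of variables: the leading coefficient in the last variable is nonzero at
    some point, so specialising there leaves a nonzero univariate polynomial, which has a non-root
    over an algebraically closed field. *)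
Lemma mpoly_nonroot (K : closedFieldType) n (p : {mpoly K[n]}) :
  p != 0 -> exists v, p.@[v] != 0.
Proof.
elim: n => [|n IHn] in p *.
  move=> p0; exists (fun=> 0); apply: contra_neq p0 => pv0; apply/mpolyP => m.
  have -> : m = 0%MM by apply/mnmP => - [].
  rewrite mcoeff0 -pv0 [in RHS](mpolyE p) raddf_sum /= [in LHS](mpolyE p) raddf_sum /=.
  apply: eq_bigr => m' _; have -> : m' = 0%MM by apply/mnmP => - [].
  by rewrite mevalZ mevalX mcoeffZ mcoeffX big_ord0 eqxx.
move=> p0; have : lead_coef (muni p) != 0.
  rewrite lead_coef_eq0; apply: contra_neq p0 => mp0.
  by rewrite -(horner_muni p) mp0 map_poly0 horner0.
case/IHn => v lv.
have : map_poly (meval v) (muni p) != 0.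
  by apply: contra_neq lv => mp0; rewrite lead_coefE -coef_map mp0 coef0.
case/closed_nonrootP => x; rewrite /root => px.
exists (extend v x); rewrite meval_muni extend_max; apply: contra_neq px => <-.
by congr _.[_]; apply: eq_map_poly => q; apply: meval_eq => i; rewrite /= extend_widen.
Qed.

(** Horner's scheme: modulo [X^2 - c], the polynomial [(b X + a) X + d] becomes [a X + (b c + d)],
    and [b] goes into the quotient. With [c = G] this brings functions on a double cover to the form
    [a + b u]. *)
Lemma poly_mod_XnsubC2 (R : comNzRingType) (c : R) (p : {poly R}) :
  exists a b q, p = q * ('X^2 - c%:P) + b%:P * 'X + a%:P.
Proof.
elim/poly_ind: p => [|p d [a [b [q ->]]]].
  by exists 0, 0, 0; rewrite polyC0 !mul0r !addr0.
by exists (b * c + d), a, (q * 'X + b%:P); rewrite polyCD polyCM; ring.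
Qed.

(** * Weighted homogeneous polynomials *)

Section WeightedHomogeneous.
Variables (K : closedFieldType) (n : nat) (w : 'I_n -> nat).
Implicit Types (g h : {mpoly K[n]}).

Lemma whomogeneousM d e g h :
  whomogeneous w d g -> whomogeneous w e h -> whomogeneous w (d + e) (g * h).
Proof.
move=> gd he m /msuppM_le /allpairsP[[m1 m2] /= [m1g m2h ->]].
rewrite -(gd _ m1g) -(he _ m2h) -big_split /=.
by apply: eq_bigr => i _; rewrite mnmDE mulnDr.
Qed.

Lemma whomogeneousD d g h :
  whomogeneous w d g -> whomogeneous w d h -> whomogeneous w d (g + h).
Proof. by move=> gd hd m /msuppD_le; rewrite mem_cat => /orP[/gd|/hd]. Qed.

Lemma whomogeneousN d g : whomogeneous w d g -> whomogeneous w d (- g).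
Proof. by move=> gd m; rewrite (perm_mem (msuppN _)) => /gd. Qed.

Lemma whomogeneousZ d (c : K) g : whomogeneous w d g -> whomogeneous w d (c *: g).
Proof. by move=> gd m /msuppZ_le /gd. Qed.

Lemma whomogeneous_sum d (I : eqType) (r : seq I) (f : I -> {mpoly K[n]}) :
  {in r, forall i, whomogeneous w d (f i)} -> whomogeneous w d (\sum_(i <- r) f i).
Proof.
move=> fd; rewrite big_seq; elim/big_ind: _ => //; last exact: whomogeneousD.
by move=> m; rewrite msupp0.
Qed.

Lemma whomogeneous1 : whomogeneous w 0 (1 : {mpoly K[n]}).
Proof.
by move=> m; rewrite -mpolyC1 msupp1 inE => /eqP ->; rewrite big1 // => i _; rewrite mnm0E muln0.
Qed.

Lemma whomogeneousX i : whomogeneous w (w i) ('X_i : {mpoly K[n]}).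
Proof.
move=> m; rewrite msuppX inE => /eqP ->; rewrite (bigD1 i) //= mnm1E eqxx muln1.
by rewrite big1 ?addn0 // => j /negPf ji; rewrite mnm1E eq_sym ji muln0.
Qed.

Lemma whomogeneous_exp d g k : whomogeneous w d g -> whomogeneous w (k * d) (g ^+ k).
Proof.
move=> gd; elim: k => [|k IHk]; first exact: whomogeneous1.
by rewrite exprS mulSn; apply: whomogeneousM.
Qed.

Lemma whomogeneous_prod (I : Type) (r : seq I) (d : I -> nat) (f : I -> {mpoly K[n]}) :
  (forall i, whomogeneous w (d i) (f i)) ->
  whomogeneous w (\sum_(i <- r) d i) (\prod_(i <- r) f i).
Proof.
move=> fd; elim/big_ind2: _ => // [|? ? ? ?]; first exact: whomogeneous1.
exact: whomogeneousM.
Qed.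

Lemma meval_whomogeneous d g (c : K) (v v' : 'I_n -> K) :
  whomogeneous w d g -> (forall i, v' i = c ^+ w i * v i) ->
  g.@[v'] = c ^+ d * g.@[v].
Proof.
move=> gd v'E; rewrite !mevalE mulr_sumr; apply: eq_big_seq => m mg.
rewrite mulrCA; congr (_ * _); rewrite -(gd _ mg) -prodrXr -big_split /=.
by apply: eq_bigr => i _; rewrite v'E exprMn exprM.
Qed.

Lemma whomogeneous_dhomog d g :
  (forall i, w i = 1%N) -> g \is d.-homog -> whomogeneous w d g.
Proof.
move=> w1 /dhomogP gd m /gd <-; rewrite -[RHS]/(mdeg m) mdegE.
by apply: eq_bigr => i _; rewrite w1 mul1n.
Qed.

Lemma wsame_refl (p : 'rV[K]_n) : wsame w p p.
Proof. by exists 1 => [|i]; rewrite ?oner_eq0 // expr1n mul1r. Qed.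

End WeightedHomogeneous.

Lemma whomogeneous_mwiden (K : closedFieldType) n (w : 'I_n.+1 -> nat) d (g : {mpoly K[n]}) :
  whomogeneous (w \o widen) d g -> whomogeneous w d (mwiden g).
Proof.
move=> gd; rewrite (mpolyE g) (raddf_sum (@mwiden n K)); apply: whomogeneous_sum => m mg.
rewrite /= mwidenZ mwidenX; apply: whomogeneousZ => _ /mem_msuppXP <-.
rewrite -(gd _ mg) big_ord_recr /= mnmwiden_ordmax muln0 addn0.
by apply: eq_bigr => i _; rewrite mnmwiden_widen.
Qed.

Lemma meval_dhomog0 (K : closedFieldType) n d (g : {mpoly K[n]}) (v : 'I_n -> K) :
  g \is d.+1.-homog -> (forall i, v i = 0) -> g.@[v] = 0.
Proof.
move=> /(whomogeneous_dhomog (w := fun=> 1%N) (fun=> erefl)) gd v0.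
(* Scaling by [c = 0] fixes the zero vector, and in positive degree it multiplies the value by 0. *)
rewrite (meval_whomogeneous (c := 0) (v := v) (v' := v) gd) ?expr0n ?mul0r // => i.
by rewrite v0 mulr0.
Qed.

(** * Rational maps given by numerators over a common denominator *)

Section RationalMap.
Variables (K : closedFieldType) (n m : nat) (w : 'I_n -> nat) (w' : 'I_m -> nat).
Variables (a : 'I_m -> {mpoly K[n]}) (b : {mpoly K[n]}).

Definition rational_map (p : 'rV[K]_n) : 'rV[K]_m :=
  \row_j ((a j).@[p 0] / b.@[p 0]).

(** This is [b ^ N] times [g (a / b)], with denominators cleared. The truncated subtraction is
    harmless once [msize g <= N], since [msize] bounds the degrees of the monomials strictly. *)
Definition pullback N (g : {mpoly K[m]}) : {mpoly K[n]} :=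
  \sum_(s <- msupp g) g@_s *: (\prod_j a j ^+ s j * b ^+ (N - mdeg s)).

Lemma meval_pullback N g (p : 'rV[K]_n) :
  b.@[p 0] != 0 -> (msize g <= N)%N ->
  (pullback N g).@[p 0] = b.@[p 0] ^+ N * g.@[rational_map p 0].
Proof.
move=> bp gN; rewrite [X in _ * X]mevalE (raddf_sum (meval (p 0))) mulr_sumr.
apply: eq_big_seq => s sg.
have sN : (mdeg s <= N)%N by apply: leq_trans gN; apply/ltnW/msize_mdeg_lt.
rewrite /= mevalZ mulrCA mevalM rmorph_prod rmorphXn /=; congr (_ * _).
rewrite -[in RHS](subnK sN) exprD -mulrA mulrC; congr (_ * _).
rewrite mdegE -prodrXr -big_split /=; apply: eq_bigr => j _.
by rewrite rmorphXn /= mxE expr_div_n mulrC divfK // expf_neq0.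
Qed.

Variable e : nat.
Hypotheses (be : whomogeneous w e b) (ae : forall j, whomogeneous w (w' j + e) (a j)).

(** Each factor [a j] has degree [e] beyond the weight [w' j], and each [b] has degree [e]. Every
    monomial yields [N] such factors in all, so the excess over [d] is always [N * e]. *)
Lemma whomogeneous_pullback d N g :
  whomogeneous w' d g -> (msize g <= N)%N -> whomogeneous w (d + N * e) (pullback N g).
Proof.
move=> gd gN; apply: whomogeneous_sum => s sg.
have sN : (mdeg s <= N)%N by apply: leq_trans gN; apply/ltnW/msize_mdeg_lt.
apply: whomogeneousZ.
have -> : (d + N * e = \sum_j s j * (w' j + e) + (N - mdeg s) * e)%N.
  rewrite -(gd _ sg) -{1}(subnK sN) mulnDl addnA addnAC; congr (_ + _)%N.
  rewrite mdegE big_distrl -big_split /=.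
  by apply: eq_bigr => j _; rewrite mulnDr (mulnC (w' j)).
apply: whomogeneousM; last exact: whomogeneous_exp.
by apply: whomogeneous_prod => j; apply: whomogeneous_exp.
Qed.

(** Since [b] has no zero on [U], a pullback vanishes at [p] exactly when the original form vanishes
    at the image; the pulled back family of equations therefore cuts out the complement of the
    preimage. *)
Lemma wopen_in_preimage (U : set 'rV[K]_n) (Y W : set 'rV[K]_m) :
  (forall p, U p -> b.@[p 0] != 0) -> (forall p, U p -> Y (rational_map p)) ->
  wopen_in w' Y W -> wopen_in w U (U `&` rational_map @^-1` W)%classic.
Proof.
move=> Ub UY [T Thom WE].
exists (fun g' => exists2 g, T g & g' = pullback (msize g) g).
  move=> _ [g Tg ->]; have [d gd] := Thom _ Tg.
  by exists (d + msize g * e)%N; apply: whomogeneous_pullback.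
move=> p; split.
  case=> Up /= /WE[_ [g Tg gp]]; split=> //; exists (pullback (msize g) g).
    by exists g.
  by rewrite meval_pullback ?Ub // mulf_neq0 // expf_neq0 // Ub.
case=> Up [_ [g Tg ->]]; rewrite meval_pullback ?Ub // mulf_eq0 => /norP[_ gp].
by split=> //=; apply/WE; split; [apply: UY | exists g].
Qed.

Lemma wmorphism_rational_map (U : set 'rV[K]_n) (Y : set 'rV[K]_m) :
  (forall p, U p -> b.@[p 0] != 0) -> (forall p, U p -> Y (rational_map p)) ->
  wmorphism w w' U Y rational_map.
Proof.
move=> Ub UY; split=> //.
(* Rescaling by [c] multiplies [a j] by [c ^ (w' j + e)] and [b] by [c ^ e], so the quotient scales
   with weight [w' j]. *)
- move=> p q Up Uq [c c0 qE]; exists c => // j; rewrite !mxE.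
  rewrite (meval_whomogeneous (@ae j) qE).
  rewrite (meval_whomogeneous be qE).
  by rewrite exprD -!mulrA [X in _ * X]mulrA -mulf_div divff ?mul1r // expf_neq0.
- by move=> W; apply: wopen_in_preimage.
move=> W f Wo freg p [Up Wp]; have [V [Vo Vp [d [g [h [gd hd fE]]]]]] := freg _ Wp.
exists ((U `&` rational_map @^-1` W) `&` rational_map @^-1` V)%classic; split=> //.
  by apply: wopen_in_preimage Vo => [q [/Ub]|q []].
(* One [N] for numerator and denominator gives both pullbacks the same degree and lets [b ^ N]
   cancel. *)
pose N := maxn (msize g) (msize h).
exists (d + N * e)%N, (pullback N g), (pullback N h).
split=> [||q [[Uq _] /= Vq]]; try by apply: whomogeneous_pullback; rewrite // ?leq_maxl ?leq_maxr.
have [hq ->] := fE _ Vq; have bq := Ub q Uq.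
rewrite !meval_pullback ?leq_maxl ?leq_maxr //.
by rewrite mulf_neq0 ?expf_neq0 // -mulf_div divff ?mul1r // expf_neq0.
Qed.

End RationalMap.

(** * Dense open subsets of double covers *)

Lemma double_coverE (K : closedFieldType) (G : {mpoly K[4]}) (p : 'rV[K]_5) :
  double_cover G p <-> p != 0 /\ p 0 ord_max ^+ 2 = G.@[p 0 \o widen].
Proof.
rewrite /double_cover /= mevalB rmorphXn /= mevalXU meval_mwiden.
by split=> - [? ] => [/subr0_eq|->]; split=> //; rewrite subrr.
Qed.

(* On the curve over a point x with [G x != 0], the polynomial [a + b u] cannot
   vanish at both points [(x, u)] and [(x, - u)] unless [a x = b x = 0]; hence
   irreducibility of the double cover is not needed. *)
Lemma double_cover_dense (K : closedFieldType) (w : 'I_5 -> nat) (G h : {mpoly K[4]})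
    (X : set 'rV[K]_5) :
  (2 : K) != 0 -> G != 0 -> h != 0 ->
  (forall p, X p -> double_cover G p) ->
  (forall p : 'rV[K]_5, p 0 ord_max ^+ 2 = G.@[p 0 \o widen] ->
    (mwiden h).@[p 0] != 0 -> X p) ->
  wdense_in w X [set p | X p /\ (mwiden h).@[p 0] != 0]%classic.
Proof.
move=> two0 G0 h0 XG GX V [T _ VE] [p /VE[/XG/double_coverE[_ pG] [g Tg gp]]].
have [a [b [q gE]]] := poly_mod_XnsubC2 G (muni g).
have evalE (r : 'rV[K]_5) : r 0 ord_max ^+ 2 = G.@[r 0 \o widen] ->
    g.@[r 0] = a.@[r 0 \o widen] + b.@[r 0 \o widen] * r 0 ord_max.
  move=> rG; rewrite meval_muni gE 2!rmorphD 2!rmorphM rmorphB /=.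
  rewrite !map_polyC map_polyX map_polyXn /=.
  rewrite !(hornerD, hornerM, hornerN, hornerC, hornerX, hornerXn).
  by rewrite -expr2 rG subrr mulr0 add0r addrC.
(* As [g] is nonzero at [p], the coefficients [a] and [b] are not both zero; [c] is a nonzero one,
   and [v] is chosen off the zeros of [c], [G] and [h] together. *)
have ab0 : exists2 c, c != 0 & c = a \/ c = b.
  have [a0|a0] := eqVneq a 0; last by exists a => //; left.
  exists b; last by right.
  by apply: contra_neq gp => b0; rewrite evalE // a0 b0 !meval0 mul0r addr0.
have [c c0 cE] := ab0.
have [v] : exists v, (c * G * h).@[v] != 0 by apply: mpoly_nonroot; rewrite !mulf_neq0.
rewrite !mevalM !mulf_eq0 !negb_or => /andP[/andP[cv Gv] hv].
have [u uE] : exists u, u ^+ 2 = G.@[v].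
  have [|u] := closed_rootP ('X^2 - (G.@[v])%:P) _; first by rewrite size_XnsubC.
  by rewrite /root !hornerE => /eqP/subr0_eq; exists u.
pose r x : 'rV[K]_5 := \row_i extend v x i.
have rv (g' : {mpoly K[4]}) x : g'.@[r x 0 \o widen] = g'.@[v].
  by apply: meval_eq => i; rewrite /= mxE extend_widen.
have ru x : r x 0 ord_max = x by rewrite mxE extend_max.
have Xr x : x ^+ 2 = G.@[v] -> X (r x) /\ (mwiden h).@[r x 0] != 0.
  have hr : (mwiden h).@[r x 0] != 0 by rewrite meval_mwiden rv.
  by move=> xE; split=> //; apply: GX; rewrite // ru rv.
have [x xE gx] : exists2 x, x ^+ 2 = G.@[v] & g.@[r x 0] != 0.
  have [gu|gu] := eqVneq g.@[r u 0] 0; last by exists u.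
  exists (- u); first by rewrite sqrrN.
  apply: contra_neq cv => gu'.
  move: gu gu'; rewrite !evalE ?ru ?rv ?sqrrN // mulrN => gu gu'.
  have u0 : u != 0 by apply: contra_neq Gv => u0; rewrite -uE u0 expr0n.
  (* The values of [g] at the two points over [v] have sum [2 a] and difference [2 b u]. *)
  case: cE => ->.
    by apply: (mulfI two0); rewrite mulr0 -[RHS]addr0 -{1}gu -gu'; ring.
  by apply: (mulIf (mulf_neq0 two0 u0)); rewrite mul0r -[RHS](subrr 0) -{1}gu -gu'; ring.
by have [Xx hx] := Xr _ xE; exists (r x); split; [apply/VE; split=> //; exists g|].
Qed.

(** * Maps compatible with the projection to P^2 *)

Section FibrewiseMap.
Variable K : closedFieldType.
Implicit Types (p q : 'rV[K]_5).

(** The composite has the shape in which two uses of [meval_mwiden] leave the evaluation point. *)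
Definition base_point p : 'I_3 -> K := (p 0 \o widen) \o widen.

Lemma row5P p q : base_point p =1 base_point q ->
  p 0 (widen ord_max) = q 0 (widen ord_max) -> p 0 ord_max = q 0 ord_max -> p = q.
Proof.
move=> pq3 pqt pqu; apply/rowP => i.
have [->//|] := eqVneq i ord_max; have [->//|] := eqVneq i (widen ord_max).
rewrite -!val_eqE /= => i3 i4.
have ilt : (i < 3)%N by case: i i3 i4 => - [|[|[|[|[|]]]]].
by have := pq3 (Ordinal ilt); congr (p 0 _ = q 0 _); apply: val_inj.
Qed.

(** A form of positive degree vanishes at the origin. This puts points with [Q <> 0] in the domain
    of the projection to P^2. *)
Lemma dhomog_base_neq0 d (Q : {mpoly K[3]}) p :
  Q \is d.+1.-homog -> Q.@[base_point p] != 0 -> exists i : 'I_5, (i < 3)%N /\ p 0 i != 0.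
Proof.
move=> Qd Qp; have [/existsP[j pj]|] := boolP [exists j, base_point p j != 0].
  by exists (widen (widen j)); split; first exact: (ltn_ord j).
rewrite negb_exists => /forallP p0; case/negP: Qp.
by rewrite (meval_dhomog0 Qd) // => j; apply/eqP; have := p0 j; rewrite negbK.
Qed.

Lemma neq0_coord p : (exists i : 'I_5, (i < 3)%N /\ p 0 i != 0) -> p != 0.
Proof. by move=> [i [_]]; apply: contra_neq => ->; rewrite mxE. Qed.

Variables (b A C : {mpoly K[5]}).

(** The factor [b] on x, y, z cancels against the denominator, so these coordinates are kept
    unchanged. *)
Definition fibrewise_num (j : 'I_5) : {mpoly K[5]} :=
  if (j < 3)%N then 'X_j * b else if (j < 4)%N then A else C.

Definition fibrewise_map : 'rV[K]_5 -> 'rV[K]_5 := rational_map fibrewise_num b.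

Lemma base_point_fibrewise p : b.@[p 0] != 0 ->
  base_point (fibrewise_map p) =1 base_point p.
Proof.
move=> bp j; rewrite /base_point /= mxE /fibrewise_num /= (ltn_ord j).
by rewrite mevalM mevalXU mulfK.
Qed.

Lemma fibrewise_mapt p : fibrewise_map p 0 (widen ord_max) = A.@[p 0] / b.@[p 0].
Proof. by rewrite mxE. Qed.

Lemma fibrewise_mapu p : fibrewise_map p 0 ord_max = C.@[p 0] / b.@[p 0].
Proof. by rewrite mxE. Qed.

Lemma wmorphism_fibrewise (w w' : 'I_5 -> nat) e (U V : set 'rV[K]_5) :
  (forall i : 'I_5, (i < 3)%N -> w i = w' i) ->
  whomogeneous w e b ->
  whomogeneous w (w' (widen ord_max) + e) A -> whomogeneous w (w' ord_max + e) C ->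
  (forall p, U p -> b.@[p 0] != 0) -> (forall p, U p -> V (fibrewise_map p)) ->
  wmorphism w w' U V fibrewise_map.
Proof.
move=> ww' be Ae Ce Ub UV; apply: (wmorphism_rational_map be) => // j.
rewrite /fibrewise_num; have [j3|j3] := ltnP j 3.
  by rewrite -ww' //; exact: (whomogeneousM (@whomogeneousX _ _ w j) be).
have [j4|j4] := ltnP j 4.
  by have -> : j = widen ord_max by apply: val_inj => /=; apply/eqP; rewrite eqn_leq j3 -ltnS j4.
by have -> : j = ord_max by apply: val_inj => /=; apply/eqP; rewrite eqn_leq j4 -ltnS ltn_ord.
Qed.

End FibrewiseMap.

Lemma wopen_in_nonzero (K : closedFieldType) n (w : 'I_n -> nat) d (X : set 'rV[K]_n)
    (h : {mpoly K[n]}) :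
  whomogeneous w d h -> wopen_in w X [set p | X p /\ h.@[p 0] != 0]%classic.
Proof.
move=> hd; exists [set h]%classic => [_ ->|p]; first by exists d.
by split=> [[Xp hp]|[Xp [_ -> hp]]]; split=> //; exists h.
Qed.

(** * Birational equivalence of the quartic and cubic families *)

Section QuarticToCubic.
Variables (K : closedFieldType) (P f a b c : {mpoly K[3]}).
Hypothesis two0 : (2 : K) != 0.
Hypotheses (P4 : P \is 4.-homog) (f1 : f \is 1.-homog).
Hypotheses (a1 : a \is 1.-homog) (b1 : b \is 1.-homog) (c1 : c \is 1.-homog).
Hypotheses (P0 : P != 0) (a0 : a != 0) (b0 : b != 0) (c0 : c != 0).

Let t : {mpoly K[4]} := 'X_ord_max.

(** In the application [f] is [F_5] and [a], [b], [c] are its differences with [F_6], [F_7], [F_8],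
    so that with [s = f + t] the factors become [s], [s - a], [s - b], [s - c]. *)
Definition quartic : {mpoly K[4]} :=
  mwiden P * ((mwiden f + t) * (mwiden (f - a) + t) *
              (mwiden (f - b) + t) * (mwiden (f - c) + t)).

(** The constants are [Q / c], [Q / b], [Q / a] for [Q = P a b c]. Setting [s = - Q / T] gives
    [s - a = - (a / T) (T + Q / a)], and likewise for [b] and [c]; hence the quartic equals
    [Q^2 / T^4] times this cubic in [T]. *)
Definition resolvent_cubic : {mpoly K[4]} :=
  (mwiden (P * b * a) + t) * (mwiden (P * c * a) + t) * (mwiden (P * c * b) + t).

Let Q : {mpoly K[3]} := P * a * b * c.

Let Q7 : Q \is 7.-homog.
Proof. exact: (dhomogM (dhomogM (dhomogM P4 a1) b1) c1). Qed.

Let linear_neq0 (g : {mpoly K[3]}) : mwiden g + t != 0.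
Proof.
(* As a polynomial in t, this linear form is monic. *)
apply: contra_neq (monic_neq0 (monicXaddC g)) => g0.
by rewrite -(muni0 3 K) -g0 muniD muni_mwiden muni_Xmax addrC.
Qed.

Let Q0 : mwiden Q != 0.
Proof. by rewrite -(mwiden0 3 K) (inj_eq (@inj_mwiden _ _)) !mulf_neq0. Qed.

Let quartic_neq0 : quartic != 0.
Proof. by rewrite !mulf_neq0 // -(mwiden0 3 K) (inj_eq (@inj_mwiden _ _)). Qed.

Let cubic_neq0 : resolvent_cubic != 0.
Proof. by rewrite !mulf_neq0. Qed.

Let q : {mpoly K[5]} := mwiden (mwiden Q).
Let u : {mpoly K[5]} := 'X_ord_max.
Let t5 : {mpoly K[5]} := 'X_(widen ord_max).
Let s : {mpoly K[5]} := mwiden (mwiden f) + t5.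

Let to_cubic := fibrewise_map (s ^+ 2) (- q * s) (q * u).
Let to_quartic := fibrewise_map (t5 ^+ 2) (- q * t5 - mwiden (mwiden f) * t5 ^+ 2) (q * u).

Let w3 (w : 'I_5 -> nat) d (g : {mpoly K[3]}) :
  (forall i : 'I_5, (i < 3)%N -> w i = 1%N) ->
  g \is d.-homog -> whomogeneous w d (mwiden (mwiden g)).
Proof.
move=> w1 gd; do 2 apply: whomogeneous_mwiden.
by apply: whomogeneous_dhomog gd => i; exact: (w1 (widen (widen i)) (ltn_ord i)).
Qed.

Let octic_w1 (i : 'I_5) : (i < 3)%N -> double_octic_weights i = 1%N.
Proof. by case: i => - [|[|[|[|[|]]]]]. Qed.

Let fibration_w1 (i : 'I_5) : (i < 3)%N -> fibration_weights i = 1%N.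
Proof. by case: i => - [|[|[|[|[|]]]]]. Qed.

Let mwidenXmax : mwiden t = t5.
Proof. by rewrite mwidenX mnmwiden1. Qed.

Let X : set 'rV[K]_5 := double_cover quartic.
Let Y : set 'rV[K]_5 := fibration_over_P2 resolvent_cubic.
Let hX : {mpoly K[4]} := mwiden Q * (mwiden f + t).
Let hY : {mpoly K[4]} := mwiden Q * t.
Let U := [set p | X p /\ (mwiden hX).@[p 0] != 0]%classic.
Let V := [set p | Y p /\ (mwiden hY).@[p 0] != 0]%classic.

(** Nonvanishing of the form [Q], of degree 7, already forces some base coordinate, hence [p], to be
    nonzero. *)
Let UE (p : 'rV[K]_5) : U p <-> [/\ p 0 ord_max ^+ 2 = quartic.@[p 0 \o widen],
  Q.@[base_point p] != 0 & f.@[base_point p] + p 0 (widen ord_max) != 0].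
Proof.
rewrite /U /X /= double_coverE /hX mwidenM mwidenD mwidenXmax (mevalM (p 0)) (mevalD (p 0)).
rewrite mulf_eq0 negb_or mevalXU !meval_mwiden; split=> [[[_ ?] /andP[]]|[? Qp ->]] //.
by rewrite Qp; split=> //; split=> //; apply/neq0_coord/(dhomog_base_neq0 Q7).
Qed.

Let VE (p : 'rV[K]_5) : V p <-> [/\ p 0 ord_max ^+ 2 = resolvent_cubic.@[p 0 \o widen],
  Q.@[base_point p] != 0 & p 0 (widen ord_max) != 0].
Proof.
rewrite /V /Y /fibration_over_P2 /= double_coverE /hY mwidenM mwidenXmax (mevalM (p 0)).
rewrite mulf_eq0 negb_or mevalXU !meval_mwiden; split=> [[[[_ ?] _] /andP[]]|[? Qp ->]] //.
have pi := dhomog_base_neq0 Q7 Qp.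
by rewrite Qp; split=> //; split=> //; split=> //; apply: neq0_coord.
Qed.

Let sE (p : 'rV[K]_5) : s.@[p 0] = f.@[base_point p] + p 0 (widen ord_max).
Proof. by rewrite mevalD mevalXU !meval_mwiden. Qed.

Let s2_neq0 p : U p -> (s ^+ 2).@[p 0] != 0.
Proof. by move=> /UE[_ _ sp]; rewrite rmorphXn /= sE expf_neq0. Qed.

Let t2_neq0 p : V p -> (t5 ^+ 2).@[p 0] != 0.
Proof. by move=> /VE[_ _ tp]; rewrite rmorphXn /= mevalXU expf_neq0. Qed.

Let quarticE (p : 'rV[K]_5) : quartic.@[p 0 \o widen] =
  let x := base_point p in let y := p 0 (widen ord_max) in
  P.@[x] * ((f.@[x] + y) * (f.@[x] - a.@[x] + y) * (f.@[x] - b.@[x] + y) * (f.@[x] - c.@[x] + y)).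
Proof. by rewrite /quartic mevalM 3!mevalM 4!mevalD mevalXU !meval_mwiden 3!mevalB. Qed.

Let cubicE (p : 'rV[K]_5) : resolvent_cubic.@[p 0 \o widen] =
  let x := base_point p in let y := p 0 (widen ord_max) in
  (P.@[x] * b.@[x] * a.@[x] + y) * (P.@[x] * c.@[x] * a.@[x] + y) *
  (P.@[x] * c.@[x] * b.@[x] + y).
Proof. by rewrite /resolvent_cubic 2!mevalM 3!mevalD mevalXU !meval_mwiden !mevalM. Qed.

Let QE (p : 'rV[K]_5) : Q.@[base_point p] =
  let x := base_point p in P.@[x] * a.@[x] * b.@[x] * c.@[x].
Proof. by rewrite /Q !mevalM. Qed.

Let to_cubicE p : U p ->
  [/\ base_point (to_cubic p) =1 base_point p,
      to_cubic p 0 (widen ord_max) =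
        - Q.@[base_point p] / (f.@[base_point p] + p 0 (widen ord_max))
    & to_cubic p 0 ord_max = Q.@[base_point p] * p 0 ord_max /
        (f.@[base_point p] + p 0 (widen ord_max)) ^+ 2].
Proof.
move=> Up; split; first by apply: base_point_fibrewise; apply: s2_neq0.
  have [_ _ sp] := (UE _).1 Up.
  rewrite fibrewise_mapt mevalM mevalN rmorphXn /= sE !meval_mwiden.
  by field.
by rewrite fibrewise_mapu mevalM mevalXU rmorphXn /= sE !meval_mwiden.
Qed.

Let to_quarticE p : V p ->
  [/\ base_point (to_quartic p) =1 base_point p,
      to_quartic p 0 (widen ord_max) =
        - Q.@[base_point p] / p 0 (widen ord_max) - f.@[base_point p]
    & to_quartic p 0 ord_max = Q.@[base_point p] * p 0 ord_max /
        p 0 (widen ord_max) ^+ 2].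
Proof.
move=> Vp; split; first by apply: base_point_fibrewise; apply: t2_neq0.
  have [_ _ tp] := (VE _).1 Vp.
  rewrite fibrewise_mapt mevalB 3!mevalM mevalN mevalXU !meval_mwiden -/(base_point p).
  by field.
by rewrite fibrewise_mapu mevalM mevalXU rmorphXn /= mevalXU !meval_mwiden.
Qed.

Let to_cubicP p : U p -> V (to_cubic p).
Proof.
move=> Up; have [pG Qp sp] := (UE _).1 Up; have [xE tE uE] := to_cubicE Up.
have gE g := meval_eq g xE.
apply/VE; rewrite cubicE /= !gE tE uE; split=> //; last by rewrite mulf_neq0 ?oppr_eq0 ?invr_neq0.
rewrite exprMn exprVn exprMn pG quarticE QE /=; field.
by rewrite sp.
Qed.

Let to_quarticP p : V p -> U (to_quartic p).
Proof.
move=> Vp; have [pG Qp tp] := (VE _).1 Vp; have [xE tE uE] := to_quarticE Vp.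
have gE g := meval_eq g xE.
apply/UE; rewrite quarticE /= !gE tE uE; split=> //; last first.
  (* The shift by [f] cancels: the image point has [s = - Q / t]. *)
  by rewrite subrKC mulf_neq0 ?oppr_eq0 ?invr_neq0.
rewrite exprMn exprVn exprMn pG cubicE QE /=; field.
by rewrite tp.
Qed.

(** Up to the shift by [f], the map [s |-> - Q / s] is an involution, and the two factors on [u],
    namely [Q / s^2] and [Q / (Q / s)^2], multiply to 1. *)
Let to_cubicK p : U p -> to_quartic (to_cubic p) = p.
Proof.
move=> Up; have [_ Qp sp] := (UE _).1 Up; have [xE tE uE] := to_cubicE Up.
have [xE' tE' uE'] := to_quarticE (to_cubicP Up).
have gE g := meval_eq g xE.
apply: row5P; first by move=> j; rewrite xE' xE.
  by rewrite tE' !gE tE; field; rewrite ?oppr_eq0 ?sp ?Qp.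
by rewrite uE' !gE tE uE; field; rewrite ?oppr_eq0 ?sp ?Qp.
Qed.

Let to_quarticK p : V p -> to_cubic (to_quartic p) = p.
Proof.
move=> Vp; have [_ Qp tp] := (VE _).1 Vp; have [xE tE uE] := to_quarticE Vp.
have [xE' tE' uE'] := to_cubicE (to_quarticP Vp).
have gE g := meval_eq g xE.
apply: row5P; first by move=> j; rewrite xE' xE.
  by rewrite tE' !gE tE subrKC; field; rewrite ?oppr_eq0 ?tp ?Qp.
by rewrite uE' !gE tE uE subrKC; field; rewrite ?oppr_eq0 ?tp ?Qp.
Qed.

Lemma birational_quartic_cubic :
  birational double_octic_weights fibration_weights
    (double_cover quartic) (fibration_over_P2 resolvent_cubic).
Proof.
have qX : whomogeneous double_octic_weights 7 q by apply: w3.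
have qY : whomogeneous fibration_weights 7 q by apply: w3.
have fX : whomogeneous double_octic_weights 1 (mwiden (mwiden f)) by apply: w3.
have fY : whomogeneous fibration_weights 1 (mwiden (mwiden f)) by apply: w3.
have tX : whomogeneous double_octic_weights 1 t5 by apply: whomogeneousX.
have tY : whomogeneous fibration_weights 6 t5 by apply: whomogeneousX.
have uX : whomogeneous double_octic_weights 4 u by apply: whomogeneousX.
have uY : whomogeneous fibration_weights 9 u by apply: whomogeneousX.
have sX : whomogeneous double_octic_weights 1 s := whomogeneousD fX tX.
(* The denominators have degrees 2 and 12; the numerators for t and u exceed them by the target
   weights, which are 6 and 9 in one direction and 1 and 4 in the other. *)
have bX : whomogeneous double_octic_weights 2 (s ^+ 2) := whomogeneous_exp sX.
have AX : whomogeneous double_octic_weights 8 (- q * s).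
  exact: whomogeneousM (whomogeneousN qX) sX.
have CX : whomogeneous double_octic_weights 11 (q * u) := whomogeneousM qX uX.
have bY : whomogeneous fibration_weights 12 (t5 ^+ 2) := whomogeneous_exp tY.
have AY : whomogeneous fibration_weights 13 (- q * t5 - mwiden (mwiden f) * t5 ^+ 2).
  apply: (whomogeneousD (whomogeneousM (whomogeneousN qY) tY)).
  exact: (whomogeneousN (whomogeneousM fY bY)).
have CY : whomogeneous fibration_weights 16 (q * u) := whomogeneousM qY uY.
have hXE : mwiden hX = q * s by rewrite mwidenM mwidenD mwidenXmax.
have hYE : mwiden hY = q * t5 by rewrite mwidenM mwidenXmax.
have t0 : t != 0 by have := linear_neq0 0; rewrite mwiden0 add0r.
have ww' (i : 'I_5) : (i < 3)%N -> double_octic_weights i = fibration_weights i.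
  by move=> i3; rewrite octic_w1 ?fibration_w1.
have w'w (i : 'I_5) (i3 : (i < 3)%N) := esym (ww' i i3).
exists U, V; split; first split.
- by apply: (@wopen_in_nonzero _ _ _ (7 + 1)); rewrite hXE; apply: (whomogeneousM qX sX).
- apply: (double_cover_dense two0 quartic_neq0 (mulf_neq0 Q0 (linear_neq0 f))) => [p|p pG hp].
    by [].
  move: hp; rewrite hXE mevalM mulf_eq0 negb_or sE !meval_mwiden => /andP[Qp sp].
  by have [] : U p by apply/UE.
- split.
    by apply: (@wopen_in_nonzero _ _ _ (7 + 6)); rewrite hYE; apply: (whomogeneousM qY tY).
  apply: (double_cover_dense two0 cubic_neq0 (mulf_neq0 Q0 t0)) => [p []|p pG hp].
    by [].
  move: hp; rewrite hYE mevalM mulf_eq0 negb_or mevalXU !meval_mwiden => /andP[Qp tp].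
  by have [] : V p by apply/VE.
exists to_cubic, to_quartic; split.
- exact: (wmorphism_fibrewise ww' bX AX CX s2_neq0 to_cubicP).
- exact: (wmorphism_fibrewise w'w bY AY CY t2_neq0 to_quarticP).
- by move=> p Up; rewrite to_cubicK //; apply: wsame_refl.
- by move=> p Vp; rewrite to_quarticK //; apply: wsame_refl.
Qed.

End QuarticToCubic.

(** * Weierstrass invariants of a split cubic *)

Section SplitCubic.
Variables (L : fieldType) (e1 e2 e3 : L).

Let E := ('X - e1%:P) * ('X - e2%:P) * ('X - e3%:P).

Lemma split_cubic_monic : E \is monic.
Proof. by rewrite !monicMr ?monicXsubC. Qed.

Lemma size_split_cubic : size E = 4%N.
Proof. by rewrite !size_Mmonic ?mulf_neq0 ?polyXsubC_eq0 ?monicXsubC // !size_XsubC. Qed.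

Lemma wc_c4_split :
  wc_c4 E = 16 * (e1 ^+ 2 + e2 ^+ 2 + e3 ^+ 2 - e1 * e2 - e1 * e3 - e2 * e3).
Proof.
have -> : E = 'X^3 - (e1 + e2 + e3)%:P * 'X^2 + (e1 * e2 + e1 * e3 + e2 * e3)%:P * 'X
    - (e1 * e2 * e3)%:P by rewrite /E !polyCD !polyCM; ring.
rewrite /wc_c4 /wc_b2 /wc_b4.
rewrite !(coefB, coefD, coefCM, coefXn, coefX, coefC) /=; ring.
Qed.

End SplitCubic.

(** The three differences [e_i - e_j] are [P] times [(x5 - x6) (x7 - x8)], [(x5 - x7) (x6 - x8)] and
    [(x5 - x8) (x6 - x7)], one for each splitting of the indices into two pairs. Their squares
    multiply to [P^6 D], and half the sum of their squares is [P^2] times the quartic form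
    [6 x5 x6 x7 x8 - T + I]. *)
Lemma split_cubic_invariants (L : fieldType) (P x5 x6 x7 x8 e1 e2 e3 : L) :
  e1 = - (P * (x5 - x7) * (x5 - x6)) -> e2 = - (P * (x5 - x8) * (x5 - x6)) ->
  e3 = - (P * (x5 - x8) * (x5 - x7)) ->
  let E := ('X - e1%:P) * ('X - e2%:P) * ('X - e3%:P) in
  let D := (x5 - x6) ^+ 2 * (x5 - x7) ^+ 2 * (x5 - x8) ^+ 2 *
           ((x6 - x7) ^+ 2 * (x6 - x8) ^+ 2 * (x7 - x8) ^+ 2) in
  let I := x5 ^+ 2 * x6 ^+ 2 + x5 ^+ 2 * x7 ^+ 2 + x5 ^+ 2 * x8 ^+ 2 +
           x6 ^+ 2 * x7 ^+ 2 + x6 ^+ 2 * x8 ^+ 2 + x7 ^+ 2 * x8 ^+ 2 in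
  let T := x5 * x6 * x7 * (x5 + x6 + x7) + x5 * x6 * x8 * (x5 + x6 + x8) +
           x5 * x7 * x8 * (x5 + x7 + x8) + x6 * x7 * x8 * (x6 + x7 + x8) in
  wc_disc E = 16 * P ^+ 6 * D /\
  ((1728 : L) != 0 -> P != 0 -> D != 0 ->
   elliptic_cubic E /\ wc_J E = 4 * (6 * (x5 * x6 * x7 * x8) - T + I) ^+ 3 / (27 * D)).
Proof.
move=> e1E e2E e3E E D I T; have discE : wc_disc E = 16 * P ^+ 6 * D.
  by rewrite wc_disc_split e1E e2E e3E /D; ring.
split=> // n0 P0 D0.
have : (2 : L) ^+ 6 * 3 ^+ 3 != 0 by have -> : (2 : L) ^+ 6 * 3 ^+ 3 = 1728 by ring.
rewrite mulf_eq0 !expf_eq0 /= negb_or => /andP[n2 n3].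
have n16 : (16 : L) != 0 by have -> : (16 : L) = 2 ^+ 4 by [ring]; rewrite expf_neq0.
have n27 : (27 : L) != 0 by have -> : (27 : L) = 3 ^+ 3 by [ring]; rewrite expf_neq0.
split; first split.
- exact: split_cubic_monic.
- exact: size_split_cubic.
- by rewrite discE; apply: mulf_neq0 (mulf_neq0 n16 (expf_neq0 _ P0)) D0.
rewrite /wc_J /wc_j discE.
have -> : wc_c4 E = 16 * P ^+ 2 * (6 * (x5 * x6 * x7 * x8) - T + I).
  by rewrite wc_c4_split e1E e2E e3E /T /I; ring.
(* The quartic form becomes an atom for [field]; the constant is [16^3 / (16 * 1728) = 4 / 27], and
   [P ^ 6] cancels. *)
move: (_ - T + I) => Q.
by field; rewrite n0 n16 n27 P0 D0.
Qed.

(** A bundle of equations, usable as one rewrite rule for all the nested index ranges. *)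
Lemma iota59 :
  (index_iota 5 9 = [:: 5; 6; 7; 8]) * (index_iota 6 9 = [:: 6; 7; 8]) *
  (index_iota 7 9 = [:: 7; 8]) * (index_iota 8 9 = [:: 8]) * (index_iota 9 9 = [::]).
Proof. by []. Qed.

Lemma sum_pairs58 (V : nmodType) (f : nat -> nat -> V) :
  \sum_(5 <= i < 9) \sum_(i.+1 <= j < 9) f i j =
  f 5 6 + f 5 7 + f 5 8 + f 6 7 + f 6 8 + f 7 8.
Proof. by rewrite iota59 !big_cons big_nil !iota59 !(big_cons, big_nil) !addr0 !addrA. Qed.

Lemma prod_pairs58 (A : pzSemiRingType) (f : nat -> nat -> A) :
  \prod_(5 <= i < 9) \prod_(i.+1 <= j < 9) f i j =
  f 5 6 * f 5 7 * f 5 8 * (f 6 7 * f 6 8 * f 7 8).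
Proof. by rewrite iota59 !big_cons big_nil !iota59 !(big_cons, big_nil) !mulr1 !mulrA. Qed.

Lemma sum_triples58 (V : nmodType) (f : nat -> nat -> nat -> V) :
  \sum_(5 <= i < 9) \sum_(i.+1 <= j < 9) \sum_(j.+1 <= k < 9) f i j k =
  f 5 6 7 + f 5 6 8 + f 5 7 8 + f 6 7 8.
Proof. by rewrite sum_pairs58 !iota59 !(big_cons, big_nil) !addr0 ?addrA. Qed.

(** * The generic fibre over C(x, y, z) *)

Section GenericFibre.
Variable K : closedFieldType.
Implicit Types (g h : {mpoly K[4]}) (c : {mpoly K[3]}).

Let tof := @FracField.tofrac {mpoly K[3]}.

Lemma generic_fibreM g h : generic_fibre (g * h) = generic_fibre g * generic_fibre h.
Proof. by rewrite /generic_fibre (muniM g h) rmorphM. Qed.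

Lemma generic_fibre_linear c :
  generic_fibre (mwiden c + 'X_ord_max) = 'X - (- tof c)%:P.
Proof.
rewrite /generic_fibre muniD muni_mwiden muni_Xmax rmorphD /= map_polyC map_polyX.
by rewrite polyCN opprK addrC.
Qed.

Lemma generic_fibre_split c1 c2 c3 :
  generic_fibre ((mwiden c1 + 'X_ord_max) * (mwiden c2 + 'X_ord_max) *
                 (mwiden c3 + 'X_ord_max)) =
  ('X - (- tof c1)%:P) * ('X - (- tof c2)%:P) * ('X - (- tof c3)%:P).
Proof.
apply: etrans (generic_fibreM _ _) _; congr (_ * _); last exact: generic_fibre_linear.
by apply: etrans (generic_fibreM _ _) _; congr (_ * _); apply: generic_fibre_linear.
Qed.

End GenericFibre.

(** The embedding [tof] into the fraction field is an injective ring morphism, so the identities and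
    the nonvanishing conditions for a split cubic carry over to the forms [F]. *)
Lemma generic_fibre_invariants (K : closedFieldType) (P : {mpoly K[3]})
    (F : nat -> {mpoly K[3]}) :
  let tof := @FracField.tofrac {mpoly K[3]} in
  let t : {mpoly K[4]} := 'X_ord_max in
  let prod_diff2 := \prod_(5 <= i < 9) \prod_(i.+1 <= j < 9) (F i - F j) ^+ 2 in
  let E := generic_fibre ((mwiden (P * (F 5 - F 7) * (F 5 - F 6)) + t) *
                          (mwiden (P * (F 5 - F 8) * (F 5 - F 6)) + t) *
                          (mwiden (P * (F 5 - F 8) * (F 5 - F 7)) + t)) in
  (1728 : K) != 0 -> P != 0 -> prod_diff2 != 0 ->
  [/\ elliptic_cubic E,
      wc_disc E = tof (16 * P ^+ 6 * prod_diff2)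
    & wc_J E =
        tof (4 * (6 * (F 5 * F 6 * F 7 * F 8)
          - \sum_(5 <= i < 9) \sum_(i.+1 <= j < 9) \sum_(j.+1 <= k < 9)
              F i * F j * F k * (F i + F j + F k)
          + \sum_(5 <= i < 9) \sum_(i.+1 <= j < 9) F i ^+ 2 * F j ^+ 2) ^+ 3)
        / tof (27 * prod_diff2)].
Proof.
move=> tof t prod_diff2 E n0 P0 prod0.
have EE := generic_fibre_split (P * (F 5 - F 7) * (F 5 - F 6))
  (P * (F 5 - F 8) * (F 5 - F 6)) (P * (F 5 - F 8) * (F 5 - F 7)).
have rootE j k : - tof (P * (F 5 - F j) * (F 5 - F k)) =
    - (tof P * (tof (F 5) - tof (F j)) * (tof (F 5) - tof (F k))).
  by rewrite /tof 2!rmorphM 2!rmorphB.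
have [discE JE] := split_cubic_invariants (rootE 7 6) (rootE 8 6) (rootE 8 7).
have prodE : tof prod_diff2 = (tof (F 5) - tof (F 6)) ^+ 2 *
    (tof (F 5) - tof (F 7)) ^+ 2 * (tof (F 5) - tof (F 8)) ^+ 2 *
    ((tof (F 6) - tof (F 7)) ^+ 2 * (tof (F 6) - tof (F 8)) ^+ 2 *
     (tof (F 7) - tof (F 8)) ^+ 2).
  by rewrite /prod_diff2 prod_pairs58 /tof; ring.
have tn0 : (1728 : {fraction {mpoly K[3]}}) != 0.
  by rewrite -(rmorph_nat tof) tofrac_eq0 -mpolyC_nat mpolyC_eq0.
have tP0 : tof P != 0 by rewrite tofrac_eq0.
have tprod0 : tof prod_diff2 != 0 by rewrite tofrac_eq0.
rewrite -EE -prodE in discE JE.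
have [ellE jE] := JE tn0 tP0 tprod0.
split; [exact: ellE | by rewrite discE /tof; ring | rewrite jE].
by rewrite sum_triples58 sum_pairs58; congr (_ / _); rewrite /tof; ring.
Qed.

(** * Octic arrangements with a fourfold point *)

Theorem theorem2p2 (R : realType) (F : nat -> {mpoly R[i][3]})
    (linF : forall k, (1 <= k <= 8)%N -> F k \is 1.-homog)
    (octF : octic_arrangement (fourfold_planes F)) :
  let t : {mpoly R[i][4]} := 'X_ord_max in
  let P := F 1%N * F 2%N * F 3%N * F 4%N in
  let octic := mwiden P * ((mwiden (F 5%N) + t) * (mwiden (F 6%N) + t) *
                           (mwiden (F 7%N) + t) * (mwiden (F 8%N) + t)) in
  let cubic := (mwiden (P * (F 5%N - F 7%N) * (F 5%N - F 6%N)) + t) *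
               (mwiden (P * (F 5%N - F 8%N) * (F 5%N - F 6%N)) + t) *
               (mwiden (P * (F 5%N - F 8%N) * (F 5%N - F 7%N)) + t) in
  let prod_diff2 := \prod_(5 <= i < 9) \prod_(i.+1 <= j < 9) (F i - F j) ^+ 2 in
  let E := generic_fibre cubic in
  [/\ (* A = (0 : 0 : 0 : 1) lies on exactly four of the planes *)
      #|[pred i : 'I_8 |
           (fourfold_planes F i).@[(delta_mx 0 ord_max : 'rV_4) 0] == 0]| = 4%N,
      birational double_octic_weights fibration_weights
        (double_cover octic) (fibration_over_P2 cubic),
      elliptic_cubic E,
      wc_disc E = FracField.tofrac (16 * P ^+ 6 * prod_diff2)
    & wc_J E =
        FracField.tofrac (4 * (6 * (F 5%N * F 6%N * F 7%N * F 8%N)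
          - \sum_(5 <= i < 9) \sum_(i.+1 <= j < 9) \sum_(j.+1 <= k < 9)
              F i * F j * F k * (F i + F j + F k)
          + \sum_(5 <= i < 9) \sum_(i.+1 <= j < 9) F i ^+ 2 * F j ^+ 2) ^+ 3)
        / FracField.tofrac (27 * prod_diff2)].
Proof.
move=> t P octic cubic prod_diff2 E; case: (octF) => lin0 inj_planes _ _.
have Fne0 k : (1 <= k <= 4)%N -> F k != 0.
  case: k => // k; rewrite /= => k4; have k8 : (k < 8)%N by apply: leq_trans k4 _.
  have [_] := lin0 (Ordinal k8); rewrite /fourfold_planes /= k4.
  by apply: contra_neq => ->; rewrite mwiden0.
(* Equal forms among [F_5], ..., [F_8] would define the same plane twice. *)
have Fsub0 i j : (5 <= i < j)%N -> (j <= 8)%N -> F i - F j != 0.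
  case: i => // i; case: j => [|j]; first by rewrite ltn0 andbF.
  rewrite !ltnS subr_eq0 => /andP[i4 ij] j8.
  have j8' : (j < 8)%N by []; have i8 := ltn_trans ij j8'; apply/eqP => Fij.
  have : Ordinal i8 = Ordinal j8'.
    have i4' : (i < 4)%N = false by rewrite ltnNge i4.
    have j4' : (j < 4)%N = false by rewrite ltnNge (leq_trans i4) // ltnW.
    by apply: inj_planes; rewrite /fourfold_planes /= i4' j4' Fij.
  by case=> ijE; rewrite ijE ltnn in ij.
have P0 : P != 0 by rewrite !mulf_neq0 ?Fne0.
have two0 : (2 : R[i]) != 0 by rewrite Num.Theory.pnatr_eq0.
have F1 k : (1 <= k <= 8)%N -> F k \is 1.-homog by apply: linF.
have diff1 i j : (1 <= i <= 8)%N -> (1 <= j <= 8)%N -> F i - F j \is 1.-homog.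
  by move=> i8 j8; rewrite rpredB ?F1.
have prod0 : prod_diff2 != 0.
  by rewrite /prod_diff2 prod_pairs58 !mulf_neq0 ?expf_neq0 ?Fsub0.
have n0 : (1728 : R[i]) != 0 by rewrite Num.Theory.pnatr_eq0.
have [ellE discE JE] := generic_fibre_invariants n0 P0 prod0.
split.
(* At A every form in x, y, z vanishes while t is 1, so exactly the first four equations hold. *)
- rewrite (eq_card (B := [pred i : 'I_8 | (i < 4)%N])) => [|i].
    by rewrite -sum1_card big_mkcond /= !big_ord_recl big_ord0.
  have Fi1 : F i.+1 \is 1.-homog by apply: linF; apply: ltn_ord.
  have FA : (mwiden (F i.+1)).@[(delta_mx 0 ord_max : 'rV_4) 0] = 0.
    rewrite meval_mwiden (meval_dhomog0 Fi1) // => j.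
    by rewrite /= mxE eqxx -val_eqE /= ltn_eqF // ltn_ord.
  rewrite !inE /fourfold_planes; case: ifP => i4; first by rewrite FA eqxx.
  by rewrite mevalD FA mevalXU add0r mxE !eqxx oner_eq0.
- have := birational_quartic_cubic two0 _ (F1 5%N isT) (diff1 5%N 6%N isT isT)
    (diff1 5%N 7%N isT isT) (diff1 5%N 8%N isT isT) P0 (Fsub0 5%N 6%N isT isT)
    (Fsub0 5%N 7%N isT isT) (Fsub0 5%N 8%N isT isT).
  (* [subKr] turns [F_5 - (F_5 - F_j)] back into [F_j]. *)
  rewrite /quartic !subKr; apply.
  exact: (dhomogM (dhomogM (dhomogM (F1 1%N isT) (F1 2%N isT)) (F1 3%N isT)) (F1 4%N isT)).
- exact: ellE.
- exact: discE.
- exact: JE.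
Qed.
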